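(* Let $\alpha:[L_1,L_2]\to\mathbb{R}^3_1$ be a unit speed spacelike curve in Minkowski 3-space with Frenet frame $\{e_1(u),e_2(u),e_3(u)\}$ and with curvature $\kappa(u)\neq 0$ for all $u$. Let $x,y,z:[L_1,L_2]\times[T_1,T_2]\to\mathbb{R}$ be $C^1$ functions such that $$\varphi(u,v)=\alpha(u)+x(u,v)\,e_1(u)+y(u,v)\,e_2(u)+z(u,v)\,e_3(u),\qquad L_1\le u\le L_2,\ T_1\le v\le T_2,$$ is a parametric spacelike surface. Then $\alpha$ is isoasymptotic on the surface $\varphi$ if and only if there exists $v_0\in[T_1,T_2]$ such that, for all $u\in[L_1,L_2]$, $$x(u,v_0)=y(u,v_0)=z(u,v_0)=0\qquad\text{and}\qquad \frac{\partial z}{\partial v}(u,v_0)=0 .$$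
   Context: Minkowski 3-space $\mathbb{R}^3_1$ is $\mathbb{R}^3$ with the Lorentzian inner product $\langle X,Y\rangle=x_1y_1+x_2y_2-x_3y_3$, also written $X\cdot Y$. A vector $X$ is spacelike if $\langle X,X\rangle>0$ or $X=0$, timelike if $\langle X,X\rangle<0$, and null if $\langle X,X\rangle=0$ and $X\ne0$. A smooth curve is spacelike if its tangent vectors are always spacelike. The vector product is $$X\times Y=(x_3y_2-x_2y_3,\;x_1y_3-x_3y_1,\;x_1y_2-x_2y_1).$$ Frenet frame: for a unit speed spacelike curve $\alpha$, $e_1=\alpha'$, $e_2$, $e_3$ are the unit tangent, principal normal and binormal vector fields; they are mutually orthogonal unit vectors (each satisfying $\langle e_i,e_i\rangle=\pm1$), and they satisfy $$e_1'=\kappa e_2,\qquad e_2'=\varepsilon\kappa e_1+\tau e_3,\qquad e_3'=\tau e_2,$$ where $\kappa,\tau$ are the curvature and torsion, and $\varepsilon=-1$ if $e_3$ is timelike, $\varepsilon=1$ if $e_3$ is spacelike. A parametric surface is spacelike if its induced metric is a positive definite Riemannian metric (equivalently, it is regular with timelike normal vector). The normal vector of $\varphi$ is $n(u,v)=\frac{\partial\varphi}{\partial u}(u,v)\times\frac{\partial\varphi}{\partial v}(u,v)$. The curve $\alpha$ is isoasymptotic on $\varphi$ if it is both a parameter curve and an asymptotic curve on $\varphi$, i.e. if there exists $v_0\in[T_1,T_2]$ such that, for all $u\in[L_1,L_2]$, $\alpha(u)=\varphi(u,v_0)$ (parameter curve) and $$\frac{\partial n}{\partial u}(u,v_0)\cdot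 e_1(u)=0$$ (asymptotic curve: the normal curvature in the direction of the velocity is zero). It is assumed that the data are regular enough for this derivative to be defined, i.e. that $u\mapsto n(u,v_0)$ is differentiable whenever $\alpha(u)=\varphi(u,v_0)$ for all $u$. *)

(* Defs.v *)
From HB Require Import structures.
From mathcomp Require Import all_boot all_order all_algebra.
From mathcomp Require Import all_classical all_reals all_analysis.

Set Implicit Arguments.
Unset Strict Implicit.
Unset Printing Implicit Defensive.

Import Order.TTheory GRing.Theory Num.Theory.
Import numFieldNormedType.Exports.

Local Open Scope classical_set_scope.
Local Open Scope ring_scope.

(* Differential calculus on a compact interval [a, b].  The library's 'derive
   takes two-sided limits; here the increments h are restricted to those with
   h + t in [a, b], so the derivative is one-sided at a and b and the values of
   f outside [a, b] play no role. *)
Definition diff_quotient (R : realType) (V : normedModType R) (f : R -> V)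
    (t h : R) : V := h^-1 *: (f (h + t) - f t).

Definition increments (R : realType) (a b t : R) : set_system R :=
  within [set h : R | a <= h + t <= b] 0^'.

Definition is_derive_in (R : realType) (V : normedModType R) (a b : R)
    (f : R -> V) (t : R) (l : V) : Prop :=
  diff_quotient f t h @[h --> increments a b t] --> l.

Definition derivable_in (R : realType) (V : normedModType R) (a b : R)
    (f : R -> V) (t : R) : Prop :=
  cvg (diff_quotient f t h @[h --> increments a b t]).

Definition derive_in (R : realType) (V : normedModType R) (a b : R)
    (f : R -> V) (t : R) : V :=
  lim (diff_quotient f t h @[h --> increments a b t]).

Definition smooth_on (R : realType) (V : normedModType R) (a b : R)
    (f : R -> V) : Prop :=
  forall (n : nat) (t : R), a <= t <= b ->
    derivable_in a b (iter n (derive_in a b) f) t.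

Definition partial_u (R : realType) (V : normedModType R) (L1 L2 : R)
    (f : R -> R -> V) (u v : R) : V := derive_in L1 L2 (fun s => f s v) u.

Definition partial_v (R : realType) (V : normedModType R) (T1 T2 : R)
    (f : R -> R -> V) (u v : R) : V := derive_in T1 T2 (f u) v.

(* C^1 on the closed rectangle [L1, L2] x [T1, T2], boundary included *)
Definition C1_on (R : realType) (V : normedModType R) (L1 L2 T1 T2 : R)
    (f : R -> R -> V) : Prop :=
  let D := [set p : R * R | L1 <= p.1 <= L2 /\ T1 <= p.2 <= T2] in
  [/\ forall u v : R, L1 <= u <= L2 -> T1 <= v <= T2 ->
        derivable_in L1 L2 (fun s => f s v) u /\ derivable_in T1 T2 (f u) v,
      {within D, continuous (fun p : R * R => partial_u L1 L2 f p.1 p.2)} &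
      {within D, continuous (fun p : R * R => partial_v T1 T2 f p.1 p.2)}].

(* Minkowski 3-space; the coordinates x_1, x_2, x_3 of X are X 0 0, X 0 1 and
   X 0 2. *)
Definition lorentz (R : realType) (X Y : 'rV[R]_3) : R :=
  X 0 0 * Y 0 0 + X 0 1 * Y 0 1 - X 0 2 * Y 0 2.

Definition vprod (R : realType) (X Y : 'rV[R]_3) : 'rV[R]_3 :=
  \row_(j < 3) [:: X 0 2 * Y 0 1 - X 0 1 * Y 0 2;
                   X 0 0 * Y 0 2 - X 0 2 * Y 0 0;
                   X 0 0 * Y 0 1 - X 0 1 * Y 0 0]`_j.

Definition spacelike (R : realType) (X : 'rV[R]_3) : bool :=
  (0 < lorentz X X) || (X == 0).

Definition timelike (R : realType) (X : 'rV[R]_3) : bool := lorentz X X < 0.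

Definition unit_vector (R : realType) (X : 'rV[R]_3) : Prop :=
  `|lorentz X X| = 1.

Definition unit_speed_spacelike_curve (R : realType) (L1 L2 : R)
    (alpha : R -> 'rV[R]_3) : Prop :=
  smooth_on L1 L2 alpha /\
  forall u : R, L1 <= u <= L2 ->
    spacelike (derive_in L1 L2 alpha u) /\
    unit_vector (derive_in L1 L2 alpha u).

(* epsilon in the Frenet equations, to be applied to e3, which is a unit vector
   and therefore spacelike when it is not timelike. *)
Definition frenet_sign (R : realType) (X : 'rV[R]_3) : R :=
  if timelike X then -1 else 1.

(* With kappa u != 0 these conditions determine e2, e3, kappa and tau up to
   sign; no orientation of e3 is imposed. *)
Definition frenet_frame (R : realType) (L1 L2 : R) (alpha : R -> 'rV[R]_3)
    (e1 e2 e3 : R -> 'rV[R]_3) (kappa tau : R -> R) : Prop :=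
  forall u : R, L1 <= u <= L2 ->
  [/\ e1 u = derive_in L1 L2 alpha u,
      [/\ unit_vector (e1 u), unit_vector (e2 u) & unit_vector (e3 u)],
      [/\ lorentz (e1 u) (e2 u) = 0, lorentz (e1 u) (e3 u) = 0
        & lorentz (e2 u) (e3 u) = 0] &
      [/\ is_derive_in L1 L2 e1 u (kappa u *: e2 u),
          is_derive_in L1 L2 e2 u
            ((frenet_sign (e3 u) * kappa u) *: e1 u + tau u *: e3 u)
        & is_derive_in L1 L2 e3 u (tau u *: e2 u)]].

Definition spacelike_surface (R : realType) (L1 L2 T1 T2 : R)
    (phi : R -> R -> 'rV[R]_3) : Prop :=
  C1_on L1 L2 T1 T2 phi /\
  forall u v : R, L1 <= u <= L2 -> T1 <= v <= T2 ->
  forall a b : R, (a, b) != (0, 0) ->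
    let X := a *: partial_u L1 L2 phi u v + b *: partial_v T1 T2 phi u v in
    0 < lorentz X X.

Definition normal (R : realType) (L1 L2 T1 T2 : R)
    (phi : R -> R -> 'rV[R]_3) (u v : R) : 'rV[R]_3 :=
  vprod (partial_u L1 L2 phi u v) (partial_v T1 T2 phi u v).

Definition parameter_curve (R : realType) (L1 L2 : R) (alpha : R -> 'rV[R]_3)
    (phi : R -> R -> 'rV[R]_3) (v0 : R) : Prop :=
  forall u : R, L1 <= u <= L2 -> alpha u = phi u v0.

Definition asymptotic_curve (R : realType) (L1 L2 T1 T2 : R)
    (e1 : R -> 'rV[R]_3) (phi : R -> R -> 'rV[R]_3) (v0 : R) : Prop :=
  forall u : R, L1 <= u <= L2 ->
    lorentz (partial_u L1 L2 (normal L1 L2 T1 T2 phi) u v0) (e1 u) = 0.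

Definition isoasymptotic (R : realType) (L1 L2 T1 T2 : R)
    (alpha e1 : R -> 'rV[R]_3) (phi : R -> R -> 'rV[R]_3) : Prop :=
  exists v0 : R, [/\ T1 <= v0 <= T2, parameter_curve L1 L2 alpha phi v0
    & asymptotic_curve L1 L2 T1 T2 e1 phi v0].

Definition frame_surface (R : realType) (alpha e1 e2 e3 : R -> 'rV[R]_3)
    (x y z : R -> R -> R) (u v : R) : 'rV[R]_3 :=
  alpha u + x u v *: e1 u + y u v *: e2 u + z u v *: e3 u.

(* Main.v *)
Require Import Defs.
From HB Require Import structures.
From mathcomp Require Import all_boot all_order all_algebra.
From mathcomp Require Import all_classical all_reals all_analysis.
From mathcomp Require Import ring lra.

(** A curve of the form [alpha = phi(., v0)] forces [x = y = z = 0] on the line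
    [v = v0], because the frame vectors are orthogonal and non-null, hence
    linearly independent.  On that line [phi_u = e1] and
    [phi_v = x_v e1 + y_v e2 + z_v e3], so the normal is
    [n = e1 x (x_v e1 + y_v e2 + z_v e3)].

    The point is to avoid computing [n'], whose explicit form would involve
    second derivatives of [y] and [z].  Since [n] is orthogonal to [e1] along the
    whole curve, differentiating [<n, e1> = 0] and using [e1' = kappa e2] gives
    [<n', e1> = - kappa <n, e2>] ([lorentz_derive_orthogonal]).  As [kappa] does
    not vanish, the curve is asymptotic iff [<n, e2> = 0].  By the symmetries of
    the triple product, [<n, e2> = z_v <e1 x e3, e2>], and the last factor is
    nonzero because its square is minus the Gram determinant of the frame
    ([lorentz_vprod_neq0]).  Hence the curve is asymptotic iff [z_v = 0]. *)

Set Implicit Arguments.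
Unset Strict Implicit.
Unset Printing Implicit Defensive.

Import Order.TTheory GRing.Theory Num.Theory.
Import numFieldNormedType.Exports.

Local Open Scope classical_set_scope.
Local Open Scope ring_scope.

(** * Lorentzian algebra *)

Section LorentzAlgebra.
Variable R : realType.
Implicit Types (X Y Z : 'rV[R]_3) (a b c : R).

Lemma lorentzC X Y : lorentz X Y = lorentz Y X.
Proof. by rewrite /lorentz; ring. Qed.

Lemma lorentzDl X Y Z : lorentz (X + Y) Z = lorentz X Z + lorentz Y Z.
Proof. by rewrite /lorentz !mxE; ring. Qed.

Lemma lorentzZl a X Y : lorentz (a *: X) Y = a * lorentz X Y.
Proof. by rewrite /lorentz !mxE; ring. Qed.

Lemma lorentzBl X Y Z : lorentz (X - Y) Z = lorentz X Z - lorentz Y Z.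
Proof. by rewrite -scaleN1r lorentzDl lorentzZl mulN1r. Qed.

Lemma lorentzZr a X Y : lorentz X (a *: Y) = a * lorentz X Y.
Proof. by rewrite lorentzC lorentzZl lorentzC. Qed.

Lemma lorentzBr X Y Z : lorentz X (Y - Z) = lorentz X Y - lorentz X Z.
Proof. by rewrite lorentzC lorentzBl !(lorentzC X). Qed.

Lemma lorentz0l X : lorentz 0 X = 0.
Proof. by rewrite -(scale0r 0) lorentzZl mul0r. Qed.

Lemma unit_vector_neq0 X : unit_vector X -> lorentz X X != 0.
Proof. by move=> uX; rewrite -normr_eq0 uX oner_neq0. Qed.

Lemma lorentz_vprod_self X Y : lorentz (vprod X Y) X = 0.
Proof. by rewrite /lorentz !mxE /=; ring. Qed.

(** The triple product is alternating, so only the component along [Z]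
    survives. *)
Lemma lorentz_vprod_lincomb X Y Z a b c :
  lorentz (vprod X (a *: X + b *: Y + c *: Z)) Y = c * lorentz (vprod X Z) Y.
Proof. by rewrite /lorentz !mxE /=; ring. Qed.

Lemma lorentz_vprod_sqr X Y Z :
  lorentz X Y = 0 -> lorentz X Z = 0 -> lorentz Y Z = 0 ->
  lorentz (vprod X Z) Y ^+ 2 = - (lorentz X X * lorentz Y Y * lorentz Z Z).
Proof.
move=> XY XZ YZ.
have gram : lorentz (vprod X Z) Y ^+ 2 =
    - (lorentz X X * lorentz Y Y * lorentz Z Z
       + (lorentz X Y * lorentz Y Z * lorentz X Z) *+ 2
       - lorentz X X * lorentz Y Z ^+ 2 - lorentz Y Y * lorentz X Z ^+ 2
       - lorentz Z Z * lorentz X Y ^+ 2).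
  by rewrite /lorentz !mxE /=; ring.
by rewrite gram XY XZ YZ; ring.
Qed.

(** The triple product is, up to sign, a determinant, so its square is up to
    sign the Gram determinant; for an orthogonal triple that is the product of
    the three non-null norms. *)
Lemma lorentz_vprod_neq0 X Y Z :
  unit_vector X -> unit_vector Y -> unit_vector Z ->
  lorentz X Y = 0 -> lorentz X Z = 0 -> lorentz Y Z = 0 ->
  lorentz (vprod X Z) Y != 0.
Proof.
move=> uX uY uZ XY XZ YZ.
by rewrite -sqrf_eq0 lorentz_vprod_sqr // oppr_eq0 !mulf_neq0 ?unit_vector_neq0.
Qed.

Lemma orthogonal_unit_free X Y Z a b c :
  unit_vector X -> unit_vector Y -> unit_vector Z ->
  lorentz X Y = 0 -> lorentz X Z = 0 -> lorentz Y Z = 0 ->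
  a *: X + b *: Y + c *: Z = 0 -> [/\ a = 0, b = 0 & c = 0].
Proof.
move=> uX uY uZ XY XZ YZ comb0.
have pair V : a * lorentz X V + b * lorentz Y V + c * lorentz Z V = 0.
  by rewrite -!lorentzZl -!lorentzDl comb0 lorentz0l.
split.
- move/eqP: (pair X); rewrite (lorentzC Y) (lorentzC Z) XY XZ !mulr0 !addr0.
  by rewrite mulf_eq0 (negbTE (unit_vector_neq0 uX)) orbF => /eqP.
- move/eqP: (pair Y); rewrite (lorentzC Z) XY YZ !mulr0 add0r addr0.
  by rewrite mulf_eq0 (negbTE (unit_vector_neq0 uY)) orbF => /eqP.
- move/eqP: (pair Z); rewrite XZ YZ !mulr0 !add0r.
  by rewrite mulf_eq0 (negbTE (unit_vector_neq0 uZ)) orbF => /eqP.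
Qed.

Lemma cvg_lorentz (T : Type) (F : set_system T) (f g : T -> 'rV[R]_3) X Y :
  Filter F -> f @ F --> X -> g @ F --> Y ->
  lorentz (f t) (g t) @[t --> F] --> lorentz X Y.
Proof.
move=> FF fX gY.
have coord (k : T -> 'rV[R]_3) (V : 'rV[R]_3) (j : 'I_3) : k @ F --> V ->
    k t 0 j @[t --> F] --> V 0 j.
  move=> kV.
  apply: (cvg_comp k (fun M : 'rV[R]_3 => M 0 j) kV).
  exact: coord_continuous.
by apply: cvgB; [apply: cvgD|]; apply: cvgM; exact: coord.
Qed.

End LorentzAlgebra.

(** * Differentiation on a compact interval *)

Section DeriveIn.
Variables (R : realType) (a b : R).
Hypothesis ab : a < b.

Lemma increments_proper (t : R) : a <= t <= b -> ProperFilter (increments a b t).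
Proof.
move=> /andP[at_ tb]; apply: Build_ProperFilter_ex => [P].
rewrite /increments /within /= => /nbhs_ballP[e /= e0 He].
have small d : 0 < d -> exists h, [/\ 0 < h, h < e & h <= d].
  move=> d0; exists (Num.min (e / 2) d).
  rewrite lt_min divr_gt0 // d0 ge_min lexx orbT gt_min.
  by rewrite ltr_pdivrMr // ltr_pMr // ltr1n.
(* Step towards an endpoint different from [t]. *)
have [tb'|bt] := ltP t b.
  have [|h [h0 he hbt]] := small (b - t); first by rewrite subr_gt0.
  exists h; apply: He => /=; [|by rewrite gt_eqF|by apply/andP; split; lra].
  by rewrite /ball /= sub0r normrN gtr0_norm.
have [|h [h0 he hta]] := small (t - a); first by rewrite subr_gt0 (lt_le_trans ab).
exists (- h); apply: He => /=.
- by rewrite /ball /= sub0r opprK gtr0_norm.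
- by rewrite oppr_eq0 gt_eqF.
- by apply/andP; split; lra.
Qed.

Lemma increments_in (t : R) : \forall h \near increments a b t, a <= h + t <= b.
Proof. exact: withinT. Qed.

Lemma increments_neq0 (t : R) : \forall h \near increments a b t, h != 0.
Proof. exact: (cvg_within _ (nbhs_dnbhs_neq (0 : R))). Qed.

Lemma increments_to0 (t : R) : h @[h --> increments a b t] --> (0 : R).
Proof.
apply: (@cvg_trans _ (h @[h --> (0 : R)^'])); first exact: cvg_within.
exact: cvg_within.
Qed.

Section Vector.
Variable V : normedModType R.
Implicit Types (f g : R -> V) (l : V).

Lemma is_derive_in_unique f t l : a <= t <= b ->
  is_derive_in a b f t l -> derive_in a b f t = l.
Proof.
by move=> tab fl; have PF := increments_proper tab; exact: (cvg_lim _ fl).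
Qed.

Lemma derivable_inP f t :
  derivable_in a b f t -> is_derive_in a b f t (derive_in a b f t).
Proof. by []. Qed.

(** The increments stay in the interval, so only values on it matter. *)
Lemma is_derive_in_eq f g t l : a <= t <= b ->
  (forall s, a <= s <= b -> f s = g s) ->
  is_derive_in a b f t l -> is_derive_in a b g t l.
Proof.
move=> tab fg; apply: cvg_trans; apply: near_eq_cvg.
apply: filterS (increments_in t) => h hab.
by rewrite /diff_quotient !fg.
Qed.

Lemma is_derive_in_cst (c : V) t : is_derive_in a b (fun=> c) t 0.
Proof.
rewrite /is_derive_in /diff_quotient.
under eq_fun do rewrite subrr scaler0.
exact: cvg_cst.
Qed.

Lemma is_derive_inD f g t l m :
  is_derive_in a b f t l -> is_derive_in a b g t m ->
  is_derive_in a b (fun s => f s + g s) t (l + m).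
Proof.
move=> fl gm; rewrite /is_derive_in.
have -> : diff_quotient (fun s => f s + g s) t =
    (fun h => diff_quotient f t h + diff_quotient g t h).
  by apply/funext => h; rewrite /diff_quotient opprD addrACA scalerDr.
exact: cvgD.
Qed.

Lemma is_derive_inZl (c : R -> R) (X : V) t (l : R) :
  is_derive_in a b c t l -> is_derive_in a b (fun s => c s *: X) t (l *: X).
Proof.
move=> cl; rewrite /is_derive_in.
have -> : diff_quotient (fun s => c s *: X) t =
    (fun h => diff_quotient c t h *: X).
  by apply/funext => h; rewrite /diff_quotient -scalerBl scalerA.
exact: cvgZr_tmp.
Qed.

Lemma is_derive_in_cvg f t l :
  is_derive_in a b f t l -> f (h + t) @[h --> increments a b t] --> f t.
Proof.
move=> fl.
have : f t + h *: diff_quotient f t h @[h --> increments a b t] -->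
    f t + 0 *: l.
  by apply: cvgD; [exact: cvg_cst | apply: cvgZ => //; exact: increments_to0].
rewrite scale0r addr0; apply: cvg_trans; apply: near_eq_cvg.
apply: filterS (increments_neq0 t) => h h0.
by rewrite /diff_quotient scalerA divff // scale1r addrC subrK.
Qed.

End Vector.

Lemma is_derive_in_lorentz (X Y : R -> 'rV[R]_3) t X' Y' :
  is_derive_in a b X t X' -> is_derive_in a b Y t Y' ->
  is_derive_in a b (fun s => lorentz (X s) (Y s)) t
    (lorentz X' (Y t) + lorentz (X t) Y').
Proof.
move=> dX dY; rewrite /is_derive_in.
have -> : diff_quotient (fun s => lorentz (X s) (Y s)) t =
    (fun h => lorentz (diff_quotient X t h) (Y (h + t))
              + lorentz (X t) (diff_quotient Y t h)).
  apply/funext => h; rewrite /diff_quotient.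
  by rewrite lorentzZl lorentzZr lorentzBl lorentzBr -mulrDr addrA subrK.
apply: cvgD; apply: cvg_lorentz => //; last exact: cvg_cst.
exact: is_derive_in_cvg dY.
Qed.

(** Differentiating [<X, Y> = 0] moves the derivative from one factor to the
    other. *)
Lemma lorentz_derive_orthogonal (X Y : R -> 'rV[R]_3) t X' Y' :
  a <= t <= b -> (forall s, a <= s <= b -> lorentz (X s) (Y s) = 0) ->
  is_derive_in a b X t X' -> is_derive_in a b Y t Y' ->
  lorentz X' (Y t) = - lorentz (X t) Y'.
Proof.
move=> tab XY0 dX dY; apply/eqP; rewrite -addr_eq0; apply/eqP.
have d0 := is_derive_in_eq tab XY0 (is_derive_in_lorentz dX dY).
rewrite -(is_derive_in_unique tab d0).
exact/(is_derive_in_unique tab)/is_derive_in_cst.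
Qed.

End DeriveIn.

(** * Surfaces along a framed curve *)

Section FrameSurface.
Variables (R : realType) (L1 L2 T1 T2 : R).
Variables (alpha e1 e2 e3 : R -> 'rV[R]_3) (kappa tau : R -> R).
Variables (x y z : R -> R -> R).
Hypotheses (hL : L1 < L2) (hT : T1 < T2).
Hypothesis hframe : frenet_frame L1 L2 alpha e1 e2 e3 kappa tau.

Let phi := frame_surface alpha e1 e2 e3 x y z.

Lemma parameter_curve_frame_surface v0 :
  parameter_curve L1 L2 alpha phi v0 <->
  forall u, L1 <= u <= L2 -> [/\ x u v0 = 0, y u v0 = 0 & z u v0 = 0].
Proof.
split=> [curve u hu|coord0 u hu].
  have [_ [u1 u2 u3] [h12 h13 h23] _] := hframe hu.
  apply: (orthogonal_unit_free u1 u2 u3 h12 h13 h23).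
  apply: (@addrI _ (alpha u)); rewrite addr0 [RHS]curve //.
  by rewrite /phi /frame_surface !addrA.
have [x0 y0 z0] := coord0 u hu.
by rewrite /phi /frame_surface x0 y0 z0 !scale0r !addr0.
Qed.

Hypotheses (hx : C1_on L1 L2 T1 T2 x) (hy : C1_on L1 L2 T1 T2 y)
  (hz : C1_on L1 L2 T1 T2 z).

Lemma partial_v_frame_surface u v : L1 <= u <= L2 -> T1 <= v <= T2 ->
  partial_v T1 T2 phi u v =
    partial_v T1 T2 x u v *: e1 u + partial_v T1 T2 y u v *: e2 u
    + partial_v T1 T2 z u v *: e3 u.
Proof.
move=> hu hv.
have dv f : C1_on L1 L2 T1 T2 f -> derivable_in T1 T2 (f u) v.
  by move=> [df _ _]; have [_] := df u v hu hv.
apply: (is_derive_in_unique hT hv).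
rewrite -[X in X + _ *: e2 u]add0r.
do 3?[apply: is_derive_inD]; first exact: is_derive_in_cst;
  by apply: is_derive_inZl; apply: derivable_inP; exact: dv.
Qed.

Variable v0 : R.
Hypotheses (hv0 : T1 <= v0 <= T2) (curve : parameter_curve L1 L2 alpha phi v0).

Lemma partial_u_parameter_curve u : L1 <= u <= L2 ->
  derivable_in L1 L2 alpha u -> partial_u L1 L2 phi u v0 = e1 u.
Proof.
move=> hu dalpha; have [-> _ _ _] := hframe hu.
apply: (is_derive_in_unique hL hu).
by apply: (is_derive_in_eq hu curve); exact: derivable_inP.
Qed.

Hypothesis dalpha : forall u, L1 <= u <= L2 -> derivable_in L1 L2 alpha u.
Hypothesis hkappa : forall u, L1 <= u <= L2 -> kappa u != 0.
Hypothesis dnormal : forall u, L1 <= u <= L2 ->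
  derivable_in L1 L2 (fun s => normal L1 L2 T1 T2 phi s v0) u.

Lemma asymptotic_curve_frame_surface :
  asymptotic_curve L1 L2 T1 T2 e1 phi v0 <->
  forall u, L1 <= u <= L2 -> partial_v T1 T2 z u v0 = 0.
Proof.
suff key u : L1 <= u <= L2 ->
    (lorentz (partial_u L1 L2 (normal L1 L2 T1 T2 phi) u v0) (e1 u) == 0)
    = (partial_v T1 T2 z u v0 == 0).
  by split=> H u hu; apply/eqP; [rewrite -key|rewrite key] => //; apply/eqP/H.
move=> hu.
have orth s : L1 <= s <= L2 ->
    lorentz (normal L1 L2 T1 T2 phi s v0) (e1 s) = 0.
  move=> hs; rewrite /normal (partial_u_parameter_curve hs (dalpha hs)).
  exact: lorentz_vprod_self.
have [_ [u1 u2 u3] [h12 h13 h23] [de1 _ _]] := hframe hu.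
rewrite (lorentz_derive_orthogonal hL hu orth (derivable_inP (dnormal hu)) de1).
rewrite lorentzZr /normal.
rewrite (partial_u_parameter_curve hu (dalpha hu)) partial_v_frame_surface //.
rewrite lorentz_vprod_lincomb oppr_eq0 !mulf_eq0 (negbTE (hkappa hu)) /=.
by rewrite (negbTE (lorentz_vprod_neq0 u1 u2 u3 h12 h13 h23)) orbF.
Qed.

End FrameSurface.

(** * Isoasymptotic curves *)

Theorem theorem3p1 (R : realType) (L1 L2 T1 T2 : R)
    (alpha e1 e2 e3 : R -> 'rV[R]_3) (kappa tau : R -> R)
    (x y z : R -> R -> R)
    (hL : L1 < L2) (hT : T1 < T2)
    (halpha : unit_speed_spacelike_curve L1 L2 alpha)
    (hframe : frenet_frame L1 L2 alpha e1 e2 e3 kappa tau)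
    (hkappa : forall u : R, L1 <= u <= L2 -> kappa u != 0)
    (hx : C1_on L1 L2 T1 T2 x)
    (hy : C1_on L1 L2 T1 T2 y)
    (hz : C1_on L1 L2 T1 T2 z)
    (hphi : spacelike_surface L1 L2 T1 T2 (frame_surface alpha e1 e2 e3 x y z))
    (hnormal : forall v0 : R, T1 <= v0 <= T2 ->
       parameter_curve L1 L2 alpha (frame_surface alpha e1 e2 e3 x y z) v0 ->
       forall u : R, L1 <= u <= L2 ->
         derivable_in L1 L2
           (fun s => normal L1 L2 T1 T2 (frame_surface alpha e1 e2 e3 x y z) s v0)
           u) :
  isoasymptotic L1 L2 T1 T2 alpha e1 (frame_surface alpha e1 e2 e3 x y z) <->
  exists2 v0 : R, T1 <= v0 <= T2 &
    forall u : R, L1 <= u <= L2 ->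
      [/\ x u v0 = 0, y u v0 = 0, z u v0 = 0 & partial_v T1 T2 z u v0 = 0].
Proof.
have dalpha u : L1 <= u <= L2 -> derivable_in L1 L2 alpha u.
  by move=> hu; case: halpha => /(_ 0%N u hu).
have asym v0 (hv0 : T1 <= v0 <= T2) curve :=
  asymptotic_curve_frame_surface hL hT hframe hx hy hz hv0 curve dalpha hkappa
    (hnormal v0 hv0 curve).
split=> [[v0 [hv0 curve /(asym _ hv0 curve) zv0]]|[v0 hv0 coord0]].
  exists v0 => // u hu.
  have [x0 y0 z0] :=
    (parameter_curve_frame_surface x y z hframe v0).1 curve u hu.
  by split=> //; exact: zv0.
have curve : parameter_curve L1 L2 alpha (frame_surface alpha e1 e2 e3 x y z) v0.
  by apply/(parameter_curve_frame_surface x y z hframe) => u /coord0[].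
exists v0; split=> //.
by apply/(asym _ hv0 curve) => u /coord0[].
Qed.
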